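(* Let $H$ be a finite group. If $R\to T$ is an $H$-Galois extension of commutative rings, then $\mathrm{Coind}_e^G(R)\to\mathrm{Coind}_e^G(T)$ is an $H$-Galois extension of $G$-Tambara functors for any finite group $G$.
   Context: An extension $R\to T$ of commutative rings, with a finite group $H$ acting on $T$ by $R$-algebra automorphisms, is $H$-Galois if $R\cong T^H$ and $T\otimes_RT\to\prod_HT$, $t_1\otimes t_2\mapsto(t_1\cdot h(t_2))_{h\in H}$, is an isomorphism. Co-induction $\mathrm{Coind}_e^G$ from commutative rings ($=e$-Tambara functors) to $G$-Tambara functors is the right adjoint of $\underline{T}\mapsto\underline{T}(G/e)$ (forgetting the $G$-action). Explicitly $\mathrm{Coind}_e^G(R)(X)=\prod_{x\in X}R$ for a finite $G$-set $X$; so $\mathrm{Coind}_e^G(R)(G/K)=\prod_{[G:K]}R$. For $f\colon X\to Y$, restriction is pullback along $f$, and transfers and norms are sums and products over the fibres of $f$. The $H$-action on $\mathrm{Coind}_e^G(T)$ is the one obtained by functoriality from the $H$-action on $T$ (componentwise). A monomorphism $\varphi\colon\underline{R}\to\underline{T}$ of $G$-Tambara functors is an $H$-Galois extension of $G$-Tambara functors if: (1) $H$ acts on the left on $\underline{T}$ through $\underline{R}$-algebra maps in $G$-Tambara functors; (2) $\varphi$ induces an isomorphism $\underline{R}\cong\underline{T}^H$, i.e. $\varphi_K\colon\underline{R}(G/K)\to\underline{T}(G/K)^H$ is an isomorphism for all subgroups $K$ of $G$; (3) the map $\chi\colon\underline{T}\Box_{\underline{R}}\underline{T}\to\prod_H\underline{T}$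 whose component at $h\in H$ is $\mu\circ(\mathrm{id}\Box h)$ is an isomorphism of $G$-Tambara functors. Here $\Box_{\underline{R}}$ is the relative box product, $\mu\colon\underline{T}\Box_{\underline{R}}\underline{T}\to\underline{T}$ is the multiplication, and products are formed levelwise. *)

(* Defs.v *)
From HB Require Import structures.
From mathcomp Require Import all_boot all_fingroup all_algebra.

Set Implicit Arguments.
Unset Strict Implicit.
Unset Printing Implicit Defensive.

Import GRing.Theory.
Local Open Scope ring_scope.

(* "Ring" means comPzRingType throughout: the zero ring is allowed, as it must
   be for the value of a Tambara functor at the empty G-set. *)

Fact ffun_mul_comm (I : finType) (R : comPzRingType) :
  commutative (@GRing.mul {ffun I -> R}).
Proof. by move=> u v; apply/ffunP => i; rewrite !ffunE mulrC. Qed.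

HB.instance Definition _ (I : finType) (R : comPzRingType) :=
  GRing.PzSemiRing_hasCommutativeMul.Build {ffun I -> R}
    (@ffun_mul_comm I R).

(** * Finite G-sets *)

(* Left actions, whereas the actions of mathcomp's action.v are right actions. *)
Record gset (gT : finGroupType) := GSet {
  gset_sort :> finType;
  gact : gT -> gset_sort -> gset_sort;
  gact1 : forall x, gact 1%g x = x;
  gactM : forall g h x, gact (g * h)%g x = gact g (gact h x) }.

Record gmap (gT : finGroupType) (X Y : gset gT) := GMap {
  gmap_fun :> X -> Y;
  gmapJ : forall g x, gmap_fun (gact g x) = gact g (gmap_fun x) }.

(* The transitive G-set G/K of left cosets x *: K, with left translation. *)
Section Cosets.
Variables (gT : finGroupType) (K : {group gT}).

Definition coset_sort : finType :=
  {A : {set gT} | A \in lcosets K [set: gT]}.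

Fact coset_act_subproof (g : gT) (A : coset_sort) :
  (g *: val A)%g \in lcosets K [set: gT].
Proof.
case: A => /= _ /lcosetsP[x _ ->].
by apply/lcosetsP; exists (g * x)%g; rewrite ?inE ?lcosetM.
Qed.

Definition coset_act (g : gT) (A : coset_sort) : coset_sort :=
  Sub (g *: val A)%g (coset_act_subproof g A).

Fact coset_act1 A : coset_act 1%g A = A.
Proof. by apply: val_inj; rewrite /= lcoset1. Qed.

Fact coset_actM g h A : coset_act (g * h)%g A = coset_act g (coset_act h A).
Proof. by apply: val_inj; rewrite /= lcosetM. Qed.

Definition coset_gset : gset gT := GSet coset_act1 coset_actM.
End Cosets.

(*     Z --f'--> E
       |         |
       g'        g
       v         v
       X --f---> Y      *)
Definition is_pullback (X Y E Z : Type)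
    (f : X -> Y) (g : E -> Y) (f' : Z -> E) (g' : Z -> X) : Prop :=
  (forall z, f (g' z) = g (f' z)) /\
  (forall x e, f x = g e -> exists! z, g' z = x /\ f' z = e).

Definition is_coproduct (X Y Z : Type) (i : X -> Z) (j : Y -> Z) : Prop :=
  bijective (fun s : X + Y => match s with inl x => i x | inr y => j y end).

(* The exponential diagram generated by A --p--> X --f--> Y:

       X <--p-- A <--e-- Z
       |                 |
       f                 q'
       v                 v
       Y <-------q------ E

   Here E is the dependent product of A along f (its points over y are the
   sections s of p over the fibre of f at y), Z is the pullback of E along f,
   and e is the evaluation map. *)
Definition is_exponential (A X Y E Z : Type) (p : A -> X) (f : X -> Y)
    (q : E -> Y) (q' : Z -> E) (e : Z -> A) : Prop :=
  is_pullback f q q' (fun z => p (e z)) /\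
  (forall (y : Y) (s : forall x, f x = y -> A),
     (forall x (fx : f x = y), p (s x fx) = x) ->
     exists! c : E, q c = y /\
       forall z (fz : f (p (e z)) = y), q' z = c -> e z = s (p (e z)) fz).

(** * Mackey functors and Tambara functors *)

(* In the functoriality axioms the composite h of f and g (resp. the identity
   f) is only specified pointwise; in particular the structure maps along two
   pointwise equal G-maps agree. *)
Record mackey (gT : finGroupType) := Mackey {
  mobj :> gset gT -> zmodType;
  mres : forall X Y, gmap X Y -> {additive mobj Y -> mobj X};
  mtr : forall X Y, gmap X Y -> {additive mobj X -> mobj Y};
  mres_id : forall X (f : gmap X X), f =1 id -> forall a, mres f a = a;
  mres_comp : forall X Y Z (f : gmap X Y) (g : gmap Y Z) (h : gmap X Z),
    h =1 g \o f -> forall a, mres h a = mres f (mres g a);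
  mtr_id : forall X (f : gmap X X), f =1 id -> forall a, mtr f a = a;
  mtr_comp : forall X Y Z (f : gmap X Y) (g : gmap Y Z) (h : gmap X Z),
    h =1 g \o f -> forall a, mtr h a = mtr g (mtr f a);
  mpullback : forall X Y E Z (f : gmap X Y) (g : gmap E Y)
      (f' : gmap Z E) (g' : gmap Z X), is_pullback f g f' g' ->
    forall a, mres g (mtr f a) = mtr f' (mres g' a);
  mempty : forall X : gset gT, #|X| = 0%N -> forall a : mobj X, a = 0;
  mcoproduct : forall X Y Z (i : gmap X Z) (j : gmap Y Z), is_coproduct i j ->
    forall a b, exists! c, mres i c = a /\ mres j c = b }.

Arguments mres {gT} M {X Y} f : rename.
Arguments mtr {gT} M {X Y} f : rename.

Record mmap (gT : finGroupType) (M N : mackey gT) := MMap {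
  mmap_fun :> forall X, {additive M X -> N X};
  mmap_res : forall X Y (f : gmap X Y) a,
    mmap_fun X (mres M f a) = mres N f (mmap_fun Y a);
  mmap_tr : forall X Y (f : gmap X Y) a,
    mmap_fun Y (mtr M f a) = mtr N f (mmap_fun X a) }.

Record tambara (gT : finGroupType) := Tambara {
  tobj :> gset gT -> comPzRingType;
  tres : forall X Y, gmap X Y -> {rmorphism tobj Y -> tobj X};
  ttr : forall X Y, gmap X Y -> {additive tobj X -> tobj Y};
  tnm : forall X Y, gmap X Y -> tobj X -> tobj Y;
  tnm_monoid : forall X Y (f : gmap X Y), GRing.monoid_morphism (tnm f);
  tres_id : forall X (f : gmap X X), f =1 id -> forall a, tres f a = a;
  tres_comp : forall X Y Z (f : gmap X Y) (g : gmap Y Z) (h : gmap X Z),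
    h =1 g \o f -> forall a, tres h a = tres f (tres g a);
  ttr_id : forall X (f : gmap X X), f =1 id -> forall a, ttr f a = a;
  ttr_comp : forall X Y Z (f : gmap X Y) (g : gmap Y Z) (h : gmap X Z),
    h =1 g \o f -> forall a, ttr h a = ttr g (ttr f a);
  tnm_id : forall X (f : gmap X X), f =1 id -> forall a, tnm f a = a;
  tnm_comp : forall X Y Z (f : gmap X Y) (g : gmap Y Z) (h : gmap X Z),
    h =1 g \o f -> forall a, tnm h a = tnm g (tnm f a);
  ttr_pullback : forall X Y E Z (f : gmap X Y) (g : gmap E Y)
      (f' : gmap Z E) (g' : gmap Z X), is_pullback f g f' g' ->
    forall a, tres g (ttr f a) = ttr f' (tres g' a);
  tnm_pullback : forall X Y E Z (f : gmap X Y) (g : gmap E Y)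
      (f' : gmap Z E) (g' : gmap Z X), is_pullback f g f' g' ->
    forall a, tres g (tnm f a) = tnm f' (tres g' a);
  texponential : forall A X Y E Z (p : gmap A X) (f : gmap X Y)
      (q : gmap E Y) (q' : gmap Z E) (e : gmap Z A),
    is_exponential p f q q' e ->
    forall a, tnm f (ttr p a) = ttr q (tnm q' (tres e a));
  tempty : forall X : gset gT, #|X| = 0%N -> forall a : tobj X, a = 0;
  tcoproduct : forall X Y Z (i : gmap X Z) (j : gmap Y Z), is_coproduct i j ->
    forall a b, exists! c, tres i c = a /\ tres j c = b }.

Arguments tres {gT} T {X Y} f : rename.
Arguments ttr {gT} T {X Y} f : rename.
Arguments tnm {gT} T {X Y} f : rename.

Definition mackey_of (gT : finGroupType) (T : tambara gT) : mackey gT :=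
  @Mackey gT (fun X => T X) (fun X Y f => tres T f) (fun X Y f => ttr T f)
    (@tres_id _ T) (@tres_comp _ T) (@ttr_id _ T) (@ttr_comp _ T)
    (@ttr_pullback _ T) (@tempty _ T) (@tcoproduct _ T).

Record tmap (gT : finGroupType) (S T : tambara gT) := TMap {
  tmap_fun :> forall X, {rmorphism S X -> T X};
  tmap_res : forall X Y (f : gmap X Y) a,
    tmap_fun X (tres S f a) = tres T f (tmap_fun Y a);
  tmap_tr : forall X Y (f : gmap X Y) a,
    tmap_fun Y (ttr S f a) = ttr T f (tmap_fun X a);
  tmap_nm : forall X Y (f : gmap X Y) a,
    tmap_fun Y (tnm S f a) = tnm T f (tmap_fun X a) }.

Definition tambara_mono (gT : finGroupType) (R T : tambara gT)
    (phi : tmap R T) : Prop :=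
  forall (S : tambara gT) (a b : tmap S R),
    (forall X s, phi X (a X s) = phi X (b X s)) ->
    forall X s, a X s = b X s.

Definition tambara_iso (gT : finGroupType) (S T : tambara gT)
    (phi : tmap S T) : Prop :=
  exists psi : tmap T S,
    (forall X s, psi X (phi X s) = s) /\ (forall X t, phi X (psi X t) = t).

(** * Relative box products *)

(* A pairing A, B -> M is a Dress pairing: a description of a map of Mackey
   functors from the box product (Day convolution) of A and B to M.  Balanced
   ones correspond to the maps out of the coequalizer of
   A [] R [] B => A [] B, i.e. out of the relative box product over R. *)
Record balanced_pairing (gT : finGroupType) (R A B : tambara gT)
    (phi : tmap R A) (psi : tmap R B) (M : mackey gT) := BalancedPairing {
  pairing :> forall X, A X -> B X -> M X;
  pairingDl : forall X (a a' : A X) (b : B X),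
    pairing (a + a') b = pairing a b + pairing a' b;
  pairingDr : forall X (a : A X) (b b' : B X),
    pairing a (b + b') = pairing a b + pairing a b';
  pairing_res : forall X Y (f : gmap X Y) (a : A Y) (b : B Y),
    mres M f (pairing a b) = pairing (tres A f a) (tres B f b);
  pairing_trl : forall X Y (f : gmap X Y) (a : A X) (b : B Y),
    pairing (ttr A f a) b = mtr M f (pairing a (tres B f b));
  pairing_trr : forall X Y (f : gmap X Y) (a : A Y) (b : B X),
    pairing a (ttr B f b) = mtr M f (pairing (tres A f a) b);
  pairing_balanced : forall X (a : A X) (r : R X) (b : B X),
    pairing (a * phi X r) b = pairing a (psi X r * b) }.

Arguments pairing {gT R A B phi psi M} th X a b : rename.

(* A relative box product of A and B over R: a Tambara functor under A and B
   such that (a, b) |-> in1 a * in2 b exhibits the underlying Mackey functor as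
   the relative box product of Mackey functors.  The Tambara structure is then
   determined: the products in1 a * in2 b generate under transfers and sums, on
   them multiplication and norms are prescribed by in1 and in2, and
   the norms of transfers and sums by the exponential diagrams. *)
Record relbox (gT : finGroupType) (R A B : tambara gT)
    (phi : tmap R A) (psi : tmap R B) := RelBox {
  box :> tambara gT;
  in1 : tmap A box;
  in2 : tmap B box;
  box_balanced : forall X r, in1 X (phi X r) = in2 X (psi X r);
  box_universal : forall (M : mackey gT) (th : balanced_pairing phi psi M),
    exists2 F : mmap (mackey_of box) M,
      forall X a b, F X (in1 X a * in2 X b) = th X a b &
      forall F' : mmap (mackey_of box) M,
        (forall X a b, F' X (in1 X a * in2 X b) = th X a b) ->
        forall X z, F' X z = F X z }.

Arguments in1 {gT R A B phi psi} _.
Arguments in2 {gT R A B phi psi} _.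

Definition box_elt (gT : finGroupType) (R A B : tambara gT)
    (phi : tmap R A) (psi : tmap R B) (P : relbox phi psi) (X : gset gT)
    (a : A X) (b : B X) : P X := in1 P X a * in2 P X b.

(* A map out of P is determined by its values on the elements box_elt a b, so
   the next two predicates each determine their last argument. *)
Definition is_box_mult (gT : finGroupType) (R T : tambara gT)
    (phi : tmap R T) (P : relbox phi phi) (mu : tmap P T) : Prop :=
  forall X (a b : T X), mu X (box_elt P a b) = a * b.

Definition is_id_box (gT : finGroupType) (R T : tambara gT)
    (phi : tmap R T) (P : relbox phi phi) (g : tmap T T)
    (idg : tmap P P) : Prop :=
  forall X (a b : T X), idg X (box_elt P a b) = box_elt P a (g X b).

(** * Co-induction and finite products *)

Lemma big_bij (V : Type) (idx : V) (op : Monoid.com_law idx)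
    (I J : finType) (P : pred I) (Q : pred J) (h : I -> J) (F : J -> V) :
  (forall i, P i -> Q (h i)) ->
  (forall j, Q j -> exists! i, P i /\ h i = j) ->
  \big[op/idx]_(j | Q j) F j = \big[op/idx]_(i | P i) F (h i).
Proof.
move=> PQ bij; rewrite -(big_imset (A := P) (h := h)) /=; last first.
  move=> i i' Pi Pi' eqh; have [k [_ uk]] := bij _ (PQ _ Pi').
  by rewrite -(uk i) ?(uk i').
apply: eq_bigl => j; apply/idP/imsetP.
  by move=> /bij[i [[Pi <-] _]]; exists i.
by move=> [i Pi ->]; exact: PQ.
Qed.

Lemma big_pullback (V : Type) (idx : V) (op : Monoid.com_law idx)
    (X Y E Z : finType) (f : X -> Y) (g : E -> Y) (f' : Z -> E) (g' : Z -> X)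
    (F : X -> V) (c : E) : is_pullback f g f' g' ->
  \big[op/idx]_(x | f x == g c) F x = \big[op/idx]_(z | f' z == c) F (g' z).
Proof.
move=> [sq pb]; apply: big_bij => [z /eqP <-|x /eqP fx]; first by rewrite sq.
have [z [[<- <-] uz]] := pb _ _ fx.
by exists z; split => // z' [/eqP ? ?]; exact: uz.
Qed.

Lemma big_comp (V : Type) (idx : V) (op : Monoid.com_law idx)
    (X Y Z : finType) (f : X -> Y) (g : Y -> Z) (h : X -> Z) (F : X -> V) z :
  h =1 g \o f ->
  \big[op/idx]_(x | h x == z) F x =
    \big[op/idx]_(y | g y == z) \big[op/idx]_(x | f x == y) F x.
Proof.
move=> hE; rewrite (partition_big f (fun y => g y == z)) => [|x]; last first.
  by rewrite hE.
apply: eq_bigr => y /eqP gy; apply: eq_bigl => x; rewrite hE /=.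
by case: (f x =P y) => [->|]; rewrite ?gy ?eqxx ?andbF.
Qed.

Lemma big_exponential (R : comPzRingType) (A X Y E Z : finType)
    (p : A -> X) (f : X -> Y) (q : E -> Y) (q' : Z -> E) (e : Z -> A)
    (u : A -> R) (y : Y) : is_exponential p f q q' e ->
  \prod_(x | f x == y) \sum_(a | p a == x) u a =
    \sum_(c | q c == y) \prod_(z | q' z == c) u (e z).
Proof.
move=> [pb univ]; have [sq pbu] := pb.
pose Q (x : X) := fun o : option A => if o is Some a then p a == x else false.
pose G (x : X) (o : option A) : R := if o is Some a then u a else 0.
have sumE x : \sum_(a | p a == x) u a = \sum_(o | Q x o) G x o.
  symmetry; apply: (@big_bij _ _ _ _ _ _ _ Some) => // -[a|] //= pa.
  by exists a; split => // a' [_ [->]].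
under eq_bigr do rewrite sumE.
rewrite (big_distr_big_dep None) /=.
pose h (c : E) : {ffun X -> option A} :=
  [ffun x => omap e [pick z | (q' z == c) && (p (e z) == x)]].
have hE c z : q' z = c -> h c (p (e z)) = Some (e z).
  move=> qz; rewrite ffunE; case: pickP => [z' /andP[/eqP qz' /eqP pz']|]; last first.
    by move=> /(_ z); rewrite qz !eqxx.
  have [k [_ uk]] := pbu (p (e z)) (q' z) (sq z).
  by rewrite /= -(uk z) // -(uk z') // qz' qz.
have hN c x : f x != q c -> h c x = None.
  move=> fx; rewrite ffunE; case: pickP => // z /andP[/eqP qz /eqP pz].
  by case/eqP: fx; rewrite -pz sq qz.
have hS c x : f x = q c -> exists2 z, q' z = c & x = p (e z).
  by move=> /pbu[z [[<- <-] _]]; exists z.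
have famE (s : {ffun X -> option A}) :
    s \in pfamily None (fun x => f x == y) Q <->
    forall x, if f x == y then Q x (s x) else s x == None.
  split=> [/familyP sP x|sP]; last apply/familyP => x.
    by have := sP x; rewrite -[x \in _]/(f x == y); case: (f x == y); rewrite inE.
  by have := sP x; rewrite -[x \in _]/(f x == y); case: (f x == y); rewrite inE.
rewrite (@big_bij _ _ _ _ _ (fun c => q c == y) _ h); first last.
- move=> s /famE sP.
  have sQ x : f x = y -> {a : A | s x = Some a & p a = x}.
    by move=> fx; move: (sP x); rewrite fx eqxx; case: (s x) => // a /eqP <-; exists a.
  have [|c [[qc cP] uc]] := univ y (fun x fx => s2val (sQ x fx)).
    by move=> x fx /=; case: (sQ x fx).
  exists c; split.
    split; first by rewrite qc.
    apply/ffunP => x; have [fx|fx] := eqVneq (f x) y.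
      have [z qz xE] := hS c x (etrans fx (esym qc)); rewrite xE hE //.
      have fz : f (p (e z)) = y by rewrite -xE.
      by rewrite {1}(cP z fz qz); case: (sQ _ fz).
    rewrite hN ?qc //.
    by move: (sP x); rewrite (negbTE fx) => /eqP.
  move=> c' [/eqP qc' hc']; apply: uc; split => // z fz qz.
  by case: (sQ _ fz) => a /= + _; rewrite -hc' hE // => -[].
- move=> c /eqP qc; apply/famE => x; have [fx|fx] := eqVneq (f x) y; last by rewrite hN ?qc.
  have [z qz ->] := hS c x (etrans fx (esym qc)).
  by rewrite hE //=.
apply: eq_bigr => c /eqP qc; rewrite -qc (big_pullback _ _ _ pb).
by apply: eq_bigr => z /eqP qz; rewrite hE.
Qed.

Section Coinduction.
Variables (gT : finGroupType) (R : comPzRingType).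
Implicit Types X Y Z : gset gT.

Definition coind_obj X : comPzRingType := {ffun X -> R}.

Definition coind_res X Y (f : gmap X Y) (u : coind_obj Y) : coind_obj X :=
  [ffun x => u (f x)].
Definition coind_tr X Y (f : gmap X Y) (u : coind_obj X) : coind_obj Y :=
  [ffun y => \sum_(x | f x == y) u x].
Definition coind_nm X Y (f : gmap X Y) (u : coind_obj X) : coind_obj Y :=
  [ffun y => \prod_(x | f x == y) u x].

Fact coind_res_zmod X Y (f : gmap X Y) : zmod_morphism (coind_res f).
Proof. by move=> u v; apply/ffunP => x; rewrite !ffunE. Qed.
Fact coind_res_monoid X Y (f : gmap X Y) :
  GRing.monoid_morphism (coind_res f).
Proof. by split=> [|u v]; apply/ffunP => x; rewrite !ffunE. Qed.
HB.instance Definition _ X Y (f : gmap X Y) :=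
  GRing.isZmodMorphism.Build (coind_obj Y) (coind_obj X) (coind_res f)
    (coind_res_zmod f).
HB.instance Definition _ X Y (f : gmap X Y) :=
  GRing.isMonoidMorphism.Build (coind_obj Y) (coind_obj X) (coind_res f)
    (coind_res_monoid f).

Fact coind_tr_zmod X Y (f : gmap X Y) : zmod_morphism (coind_tr f).
Proof.
move=> u v; apply/ffunP => y; rewrite !ffunE -sumrB.
by apply: eq_bigr => x _; rewrite !ffunE.
Qed.
HB.instance Definition _ X Y (f : gmap X Y) :=
  GRing.isZmodMorphism.Build (coind_obj X) (coind_obj Y) (coind_tr f)
    (coind_tr_zmod f).

Fact coind_nm_monoid X Y (f : gmap X Y) : GRing.monoid_morphism (coind_nm f).
Proof.
split=> [|u v]; apply/ffunP => y; rewrite !ffunE.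
  by rewrite big1 // => x _; rewrite ffunE.
by rewrite -big_split; apply: eq_bigr => x _; rewrite !ffunE.
Qed.

Fact coind_res_id X (f : gmap X X) : f =1 id -> forall u, coind_res f u = u.
Proof. by move=> fE u; apply/ffunP => x; rewrite ffunE fE. Qed.

Fact coind_res_comp X Y Z (f : gmap X Y) (g : gmap Y Z) (h : gmap X Z) :
  h =1 g \o f -> forall u, coind_res h u = coind_res f (coind_res g u).
Proof. by move=> hE u; apply/ffunP => x; rewrite !ffunE hE. Qed.

Fact coind_tr_id X (f : gmap X X) : f =1 id -> forall u, coind_tr f u = u.
Proof.
by move=> fE u; apply/ffunP => x; rewrite ffunE (big_pred1 x) // => z /=;
  rewrite fE.
Qed.

Fact coind_tr_comp X Y Z (f : gmap X Y) (g : gmap Y Z) (h : gmap X Z) :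
  h =1 g \o f -> forall u, coind_tr h u = coind_tr g (coind_tr f u).
Proof.
move=> hE u; apply/ffunP => z; rewrite !ffunE (big_comp _ _ _ hE).
by apply: eq_bigr => y _; rewrite ffunE.
Qed.

Fact coind_nm_id X (f : gmap X X) : f =1 id -> forall u, coind_nm f u = u.
Proof.
by move=> fE u; apply/ffunP => x; rewrite ffunE (big_pred1 x) // => z /=;
  rewrite fE.
Qed.

Fact coind_nm_comp X Y Z (f : gmap X Y) (g : gmap Y Z) (h : gmap X Z) :
  h =1 g \o f -> forall u, coind_nm h u = coind_nm g (coind_nm f u).
Proof.
move=> hE u; apply/ffunP => z; rewrite !ffunE (big_comp _ _ _ hE).
by apply: eq_bigr => y _; rewrite ffunE.
Qed.

Fact coind_tr_pullback X Y E Z (f : gmap X Y) (g : gmap E Y)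
    (f' : gmap Z E) (g' : gmap Z X) : is_pullback f g f' g' ->
  forall u, coind_res g (coind_tr f u) = coind_tr f' (coind_res g' u).
Proof.
move=> pb u; apply/ffunP => c; rewrite !ffunE (big_pullback _ _ _ pb).
by apply: eq_bigr => z _; rewrite ffunE.
Qed.

Fact coind_nm_pullback X Y E Z (f : gmap X Y) (g : gmap E Y)
    (f' : gmap Z E) (g' : gmap Z X) : is_pullback f g f' g' ->
  forall u, coind_res g (coind_nm f u) = coind_nm f' (coind_res g' u).
Proof.
move=> pb u; apply/ffunP => c; rewrite !ffunE (big_pullback _ _ _ pb).
by apply: eq_bigr => z _; rewrite ffunE.
Qed.

Fact coind_exponential A X Y E Z (p : gmap A X) (f : gmap X Y)
    (q : gmap E Y) (q' : gmap Z E) (e : gmap Z A) :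
  is_exponential p f q q' e ->
  forall u, coind_nm f (coind_tr p u) =
            coind_tr q (coind_nm q' (coind_res e u)).
Proof.
move=> ex u; apply/ffunP => y; rewrite !ffunE.
under eq_bigr do rewrite ffunE; rewrite (big_exponential _ _ ex).
apply: eq_bigr => c _; rewrite ffunE.
by apply: eq_bigr => z _; rewrite ffunE.
Qed.

Fact coind_empty X : #|X| = 0%N -> forall u : coind_obj X, u = 0.
Proof. by move=> /card0_eq X0 u; apply/ffunP => x; have := X0 x. Qed.

Fact coind_coproduct X Y Z (i : gmap X Z) (j : gmap Y Z) : is_coproduct i j ->
  forall u v, exists! w, coind_res i w = u /\ coind_res j w = v.
Proof.
case=> k kK Kk u v.
exists [ffun z => match k z with inl x => u x | inr y => v y end]; split.
  split; apply/ffunP => x; rewrite !ffunE.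
    by rewrite (kK (inl x)).
  by rewrite (kK (inr x)).
move=> w [<- <-]; apply/ffunP => z; rewrite ffunE -{2}(Kk z).
by case: (k z) => x; rewrite ffunE.
Qed.

Definition coind : tambara gT :=
  @Tambara gT coind_obj
    (fun X Y f => coind_res f : {rmorphism coind_obj Y -> coind_obj X})
    (fun X Y f => coind_tr f : {additive coind_obj X -> coind_obj Y})
    coind_nm coind_nm_monoid coind_res_id coind_res_comp
    coind_tr_id coind_tr_comp coind_nm_id coind_nm_comp
    coind_tr_pullback coind_nm_pullback coind_exponential
    coind_empty coind_coproduct.
End Coinduction.

Section CoinductionMap.
Variables (gT : finGroupType) (R S : comPzRingType) (f : {rmorphism R -> S}).

Definition coind_map_fun (X : gset gT) (u : coind gT R X) : coind gT S X :=
  [ffun x => f (u x)].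

Fact coind_map_zmod X : zmod_morphism (@coind_map_fun X).
Proof. by move=> u v; apply/ffunP => x; rewrite !ffunE rmorphB. Qed.
Fact coind_map_monoid X : GRing.monoid_morphism (@coind_map_fun X).
Proof.
by split=> [|u v]; apply/ffunP => x; rewrite !ffunE ?rmorph1 ?rmorphM.
Qed.
HB.instance Definition _ X :=
  GRing.isZmodMorphism.Build (coind gT R X) (coind gT S X) (@coind_map_fun X)
    (@coind_map_zmod X).
HB.instance Definition _ X :=
  GRing.isMonoidMorphism.Build (coind gT R X) (coind gT S X)
    (@coind_map_fun X) (@coind_map_monoid X).

Fact coind_map_res X Y (g : gmap X Y) u :
  coind_map_fun (tres (coind gT R) g u) =
  tres (coind gT S) g (coind_map_fun u).
Proof. by apply/ffunP => x; rewrite !ffunE. Qed.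

Fact coind_map_tr X Y (g : gmap X Y) u :
  coind_map_fun (ttr (coind gT R) g u) = ttr (coind gT S) g (coind_map_fun u).
Proof.
apply/ffunP => y; rewrite !ffunE rmorph_sum.
by apply: eq_bigr => x _; rewrite ffunE.
Qed.

Fact coind_map_nm X Y (g : gmap X Y) u :
  coind_map_fun (tnm (coind gT R) g u) = tnm (coind gT S) g (coind_map_fun u).
Proof.
apply/ffunP => y; rewrite !ffunE rmorph_prod.
by apply: eq_bigr => x _; rewrite ffunE.
Qed.

Definition coind_map : tmap (coind gT R) (coind gT S) :=
  @TMap gT (coind gT R) (coind gT S)
    (fun X => @coind_map_fun X : {rmorphism coind gT R X -> coind gT S X})
    coind_map_res coind_map_tr coind_map_nm.
End CoinductionMap.

(* The product of copies of T indexed by I, formed levelwise. *)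
Section Product.
Variables (gT : finGroupType) (I : finType) (T : tambara gT).
Implicit Types X Y Z : gset gT.

Definition tprod_obj X : comPzRingType := {ffun I -> T X}.

Definition tprod_res X Y (f : gmap X Y) (u : tprod_obj Y) : tprod_obj X :=
  [ffun i => tres T f (u i)].
Definition tprod_tr X Y (f : gmap X Y) (u : tprod_obj X) : tprod_obj Y :=
  [ffun i => ttr T f (u i)].
Definition tprod_nm X Y (f : gmap X Y) (u : tprod_obj X) : tprod_obj Y :=
  [ffun i => tnm T f (u i)].

Fact tprod_res_zmod X Y (f : gmap X Y) : zmod_morphism (tprod_res f).
Proof. by move=> u v; apply/ffunP => i; rewrite !ffunE rmorphB. Qed.
Fact tprod_res_monoid X Y (f : gmap X Y) :
  GRing.monoid_morphism (tprod_res f).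
Proof.
by split=> [|u v]; apply/ffunP => i; rewrite !ffunE ?rmorph1 ?rmorphM.
Qed.
HB.instance Definition _ X Y (f : gmap X Y) :=
  GRing.isZmodMorphism.Build (tprod_obj Y) (tprod_obj X) (tprod_res f)
    (tprod_res_zmod f).
HB.instance Definition _ X Y (f : gmap X Y) :=
  GRing.isMonoidMorphism.Build (tprod_obj Y) (tprod_obj X) (tprod_res f)
    (tprod_res_monoid f).

Fact tprod_tr_zmod X Y (f : gmap X Y) : zmod_morphism (tprod_tr f).
Proof. by move=> u v; apply/ffunP => i; rewrite !ffunE raddfB. Qed.
HB.instance Definition _ X Y (f : gmap X Y) :=
  GRing.isZmodMorphism.Build (tprod_obj X) (tprod_obj Y) (tprod_tr f)
    (tprod_tr_zmod f).

Fact tprod_nm_monoid X Y (f : gmap X Y) : GRing.monoid_morphism (tprod_nm f).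
Proof.
by split=> [|u v]; apply/ffunP => i; rewrite !ffunE;
  case: (tnm_monoid T f) => n1 nM; rewrite ?n1 ?nM.
Qed.

Fact tprod_res_id X (f : gmap X X) : f =1 id -> forall u, tprod_res f u = u.
Proof. by move=> fE u; apply/ffunP => i; rewrite ffunE tres_id. Qed.

Fact tprod_res_comp X Y Z (f : gmap X Y) (g : gmap Y Z) (h : gmap X Z) :
  h =1 g \o f -> forall u, tprod_res h u = tprod_res f (tprod_res g u).
Proof.
by move=> hE u; apply/ffunP => i; rewrite !ffunE (tres_comp hE).
Qed.

Fact tprod_tr_id X (f : gmap X X) : f =1 id -> forall u, tprod_tr f u = u.
Proof. by move=> fE u; apply/ffunP => i; rewrite ffunE ttr_id. Qed.

Fact tprod_tr_comp X Y Z (f : gmap X Y) (g : gmap Y Z) (h : gmap X Z) :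
  h =1 g \o f -> forall u, tprod_tr h u = tprod_tr g (tprod_tr f u).
Proof.
by move=> hE u; apply/ffunP => i; rewrite !ffunE (ttr_comp hE).
Qed.

Fact tprod_nm_id X (f : gmap X X) : f =1 id -> forall u, tprod_nm f u = u.
Proof. by move=> fE u; apply/ffunP => i; rewrite ffunE tnm_id. Qed.

Fact tprod_nm_comp X Y Z (f : gmap X Y) (g : gmap Y Z) (h : gmap X Z) :
  h =1 g \o f -> forall u, tprod_nm h u = tprod_nm g (tprod_nm f u).
Proof.
by move=> hE u; apply/ffunP => i; rewrite !ffunE (tnm_comp hE).
Qed.

Fact tprod_tr_pullback X Y E Z (f : gmap X Y) (g : gmap E Y)
    (f' : gmap Z E) (g' : gmap Z X) : is_pullback f g f' g' ->
  forall u, tprod_res g (tprod_tr f u) = tprod_tr f' (tprod_res g' u).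
Proof.
by move=> pb u; apply/ffunP => i; rewrite !ffunE (ttr_pullback pb).
Qed.

Fact tprod_nm_pullback X Y E Z (f : gmap X Y) (g : gmap E Y)
    (f' : gmap Z E) (g' : gmap Z X) : is_pullback f g f' g' ->
  forall u, tprod_res g (tprod_nm f u) = tprod_nm f' (tprod_res g' u).
Proof.
by move=> pb u; apply/ffunP => i; rewrite !ffunE (tnm_pullback pb).
Qed.

Fact tprod_exponential A X Y E Z (p : gmap A X) (f : gmap X Y)
    (q : gmap E Y) (q' : gmap Z E) (e : gmap Z A) :
  is_exponential p f q q' e ->
  forall u, tprod_nm f (tprod_tr p u) =
            tprod_tr q (tprod_nm q' (tprod_res e u)).
Proof.
by move=> ex u; apply/ffunP => i; rewrite !ffunE (texponential ex).
Qed.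

Fact tprod_empty X : #|X| = 0%N -> forall u : tprod_obj X, u = 0.
Proof. by move=> X0 u; apply/ffunP => i; rewrite !ffunE; exact: tempty. Qed.

Fact tprod_coproduct X Y Z (i : gmap X Z) (j : gmap Y Z) : is_coproduct i j ->
  forall u v, exists! w, tprod_res i w = u /\ tprod_res j w = v.
Proof.
move=> ij u v.
have ex k : exists c : T Z,
    (tres T i c == u k) && (tres T j c == v k).
  have [c [[ic jc] _]] := tcoproduct ij (u k) (v k).
  by exists c; rewrite ic jc !eqxx.
exists [ffun k => xchoose (ex k)]; split.
  by split; apply/ffunP => k; rewrite !ffunE;
    have /andP[/eqP ? /eqP ?] := xchooseP (ex k).
move=> w [wu wv]; apply/ffunP => k; rewrite ffunE.
have [c [_ uc]] := tcoproduct ij (u k) (v k).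
have /andP[/eqP eu /eqP ev] := xchooseP (ex k).
rewrite -(uc _ (conj eu ev)); apply: uc.
by split; [rewrite -wu ffunE | rewrite -wv ffunE].
Qed.

Definition tprod : tambara gT :=
  @Tambara gT tprod_obj
    (fun X Y f => tprod_res f : {rmorphism tprod_obj Y -> tprod_obj X})
    (fun X Y f => tprod_tr f : {additive tprod_obj X -> tprod_obj Y})
    tprod_nm tprod_nm_monoid tprod_res_id tprod_res_comp
    tprod_tr_id tprod_tr_comp tprod_nm_id tprod_nm_comp
    tprod_tr_pullback tprod_nm_pullback tprod_exponential
    tprod_empty tprod_coproduct.
End Product.

(** * Galois extensions *)

(* The map f : A -> B induces a bijection from A onto the fixed points B^H. *)
Definition iso_onto_fixed (H A B : Type) (act : H -> B -> B) (f : A -> B) :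
    Prop :=
  (forall h a, act h (f a) = f a) /\
  (forall b, (forall h, act h b = b) -> exists! a, f a = b).

Record tensor_product (R A B : comPzRingType)
    (f : {rmorphism R -> A}) (g : {rmorphism R -> B}) := TensorProduct {
  tensor :> zmodType;
  tens : A -> B -> tensor;
  tensDl : forall a a' b, tens (a + a') b = tens a b + tens a' b;
  tensDr : forall a b b', tens a (b + b') = tens a b + tens a b';
  tens_balanced : forall a r b, tens (a * f r) b = tens a (g r * b);
  tensor_universal : forall (M : zmodType) (th : A -> B -> M),
    (forall a a' b, th (a + a') b = th a b + th a' b) ->
    (forall a b b', th a (b + b') = th a b + th a b') ->
    (forall a r b, th (a * f r) b = th a (g r * b)) ->
    exists2 F : {additive tensor -> M},
      forall a b, F (tens a b) = th a b &
      forall F' : {additive tensor -> M},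
        (forall a b, F' (tens a b) = th a b) -> F' =1 F }.

(* H-Galois extensions i : R -> T, where H = hT acts on T through sigma.  The
   last clause does not depend on the choice of the tensor product P, and chi
   is determined by P. *)
Definition ring_galois (hT : finGroupType) (R T : comPzRingType)
    (i : {rmorphism R -> T}) (sigma : hT -> {rmorphism T -> T}) : Prop :=
  [/\ (forall t, sigma 1%g t = t) /\
        (forall g h t, sigma (g * h)%g t = sigma g (sigma h t)),
      (forall h r, sigma h (i r) = i r),
      iso_onto_fixed sigma i &
      exists (P : tensor_product i i) (chi : {additive P -> {ffun hT -> T}}),
        (forall t1 t2, chi (tens P t1 t2) = [ffun h => t1 * sigma h t2]) /\
        bijective chi].

(* H-Galois extensions of Tambara functors.  As above, the last clause does not
   depend on the choice of the relative box product P, and mu, idbox and chi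
   are determined by P; chi is the map whose component at h is
   mu o (id [] h). *)
Definition tambara_galois (hT gT : finGroupType) (R T : tambara gT)
    (phi : tmap R T) (sigma : hT -> tmap T T) : Prop :=
  tambara_mono phi /\
  [/\ (forall X (t : T X), sigma 1%g X t = t) /\
        (forall g h X (t : T X), sigma (g * h)%g X t = sigma g X (sigma h X t)),
      (forall h X (r : R X), sigma h X (phi X r) = phi X r),
      (forall K : {group gT},
        iso_onto_fixed (fun h => sigma h (coset_gset K)) (phi (coset_gset K))) &
      exists (P : relbox phi phi) (mu : tmap P T) (idbox : hT -> tmap P P)
          (chi : tmap P (tprod hT T)),
        [/\ is_box_mult mu,
            (forall h, is_id_box (sigma h) (idbox h)),
            (forall X (z : P X),
              chi X z = [ffun h => mu X (idbox h X z)] :> {ffun hT -> T X}) &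
            tambara_iso chi]].

(* Main.v *)
From HB Require Import structures.
From mathcomp Require Import all_boot all_fingroup all_algebra.
Require Import Defs.

Set Implicit Arguments.
Unset Strict Implicit.
Unset Printing Implicit Defensive.

Import GRing.Theory.
Local Open Scope ring_scope.

(** Write H for hT, G for gT and T^H for the ring of functions from H to T.
    The heart of the matter is that co-induction carries the relative tensor
    product of rings to the relative box product, so that
    Coind T [] Coind T over Coind R is Coind (T (x)_R T), which is
    Coind (T^H) because R -> T is H-Galois.  Exchanging the two indices
    identifies Coind (T^H) levelwise with the product of H copies of Coind T,
    and this exchange is chi.

    Co-induction commutes with the box product because, G being finite, it is
    also a left adjoint: a map of Mackey functors from Coind A to M is the same
    as an additive map alpha from A to M(G), where G stands for the regular
    G-set.  The map attached to alpha sends u in A^X to the sum over x in X of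
    the transfers of alpha (u x) along the orbit maps g |-> g x from G to X
    (coind_ext, coind_ext_unique).  Its compatibility with restrictions is the
    double coset formula res_orbit_tr: the pullback of an orbit map G -> Y
    along f : X -> Y is a disjoint union of copies of G, indexed by the fibre
    of f.  What this needs is that an element of M at a free G-set is
    detected by its restrictions along orbit maps (free_res_eq0), which follows
    from additivity by splitting off one orbit at a time.

    In the same way a balanced pairing of Coind A and Coind B with values in M
    is determined by the balanced biadditive map that it induces from A and B
    to M(G) on functions supported at the unit of G (pairing_sum_points).
    Together with the adjunction this gives the universal property of the
    relative box product (coind_box_universal).

    The other clauses hold pointwise: Coind i is injective at every level and
    its image consists of the H-fixed functions, because this holds for i. *)

(** * The regular G-set and free G-sets *)

Section Regular.
Variable gT : finGroupType.
Implicit Types (X : gset gT) (g h : gT).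

Definition regular_gset : gset gT :=
  @GSet gT gT (fun g x => (g * x)%g) (@mul1g gT)
    (fun g h x => esym (mulgA g h x)).

Definition orbit_map X (x : X) : gmap regular_gset X :=
  @GMap gT regular_gset X (fun g => gact g x) (fun g h => gactM g h x).

Definition empty_gset : gset gT :=
  @GSet gT void (fun _ x => x) (fun x => erefl) (fun _ _ x => erefl).

Definition from_empty X : gmap empty_gset X :=
  @GMap gT empty_gset X (of_void X)
    (fun _ (x : empty_gset) => match x with end).

Section OrbitComplement.
Variables (X : gset gT) (x0 : X).

Definition orbit_compl_sort : finType :=
  {x : X | [forall g, x != gact g x0]}.

Fact orbit_compl_subproof g (x : orbit_compl_sort) :
  [forall h, gact g (val x) != gact h x0].
Proof.
case: x => x /= /forallP xP; apply/forallP => h; apply/eqP => gx.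
by have /eqP[] := xP (g^-1 * h)%g; rewrite gactM -gx -gactM mulVg gact1.
Qed.

Definition orbit_compl_act g (x : orbit_compl_sort) : orbit_compl_sort :=
  Sub (gact g (val x)) (orbit_compl_subproof g x).

Fact orbit_compl_act1 x : orbit_compl_act 1%g x = x.
Proof. by apply: val_inj; rewrite /= gact1. Qed.

Fact orbit_compl_actM g h x :
  orbit_compl_act (g * h)%g x = orbit_compl_act g (orbit_compl_act h x).
Proof. by apply: val_inj; rewrite /= gactM. Qed.

Definition orbit_compl : gset gT := GSet orbit_compl_act1 orbit_compl_actM.

Definition orbit_compl_incl : gmap orbit_compl X :=
  @GMap gT orbit_compl X val (fun _ _ => erefl).

(** The stabiliser of x0 being trivial, its orbit is a copy of the regular
    G-set.  The bijection is obtained by counting: the map is injective and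
    has a section. *)
Lemma orbit_coproduct : (forall g, gact g x0 = x0 -> g = 1%g) ->
  is_coproduct (orbit_map x0) orbit_compl_incl.
Proof.
move=> x0_free; apply: inj_card_bij => [[g|y] [h|z] /=|].
- move=> gh; congr inl; apply/eqP; rewrite eq_sym eq_mulVg1; apply/eqP.
  by apply: x0_free; rewrite gactM gh -gactM mulVg gact1.
- by case: z => z /= zP gz; have /eqP[] := forallP zP g.
- by case: y => y /= yP yh; have /eqP[] := forallP yP h.
- by move/val_inj->.
pose k (x : X) : regular_gset + orbit_compl :=
  if [pick g | x == gact g x0] is Some g then inl g
  else if insub x is Some y then inr y else inl 1%g.
suff kK : cancel k (fun s => match s with inl g => orbit_map x0 g
                             | inr y => orbit_compl_incl y end).
  exact: leq_card (can_inj kK).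
move=> x; rewrite /k; case: pickP => [g /eqP -> //|xP].
by rewrite insubT //=; apply/forallP => g; rewrite xP.
Qed.

End OrbitComplement.

(** By additivity of M along the decomposition of X into the orbit of a point
    and its complement, which is again free, and induction on the cardinal
    of X. *)
Lemma free_res_eq0 (M : mackey gT) X (c : M X) :
    (forall g (x : X), gact g x = x -> g = 1%g) ->
  (forall x : X, mres M (orbit_map x) c = 0) -> c = 0.
Proof.
have [n] := ubnP #|X|; elim: n => // n IHn in X c *.
move=> leXn free c0; have [X0|] := posnP #|X|; first exact: mempty.
case/card_gt0P => x0 _; set j := orbit_compl_incl x0.
have jc0 : mres M j c = 0.
  apply: IHn => [|g x /(congr1 val)/free //|x].
    apply: leq_trans (leXn : (#|X| <= n)%N).
    rewrite -(card_image val_inj); apply: proper_card.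
    apply/properP; split; first by apply/subsetP.
    exists x0 => //; apply/imageP => -[[y /= yP] _ yx0].
    by have := forallP yP 1%g; rewrite gact1 yx0 eqxx.
  by rewrite -(@mres_comp _ M _ _ _ _ _ (orbit_map (val x))) //= c0.
have [d [_ dU]] := mcoproduct (orbit_coproduct (free^~ x0)) (0 : M _) (0 : M _).
by rewrite -(dU c) ?(dU 0) ?raddf0 ?c0 ?jc0.
Qed.

End Regular.

(** * The double coset formula for orbit maps *)

Section DoubleCoset.
Variable gT : finGroupType.
Implicit Types (X : gset gT) (g h : gT).

Section Copies.
Variable I : finType.

Definition copies_act g (x : I * gT) : I * gT := (x.1, (g * x.2)%g).

Fact copies_act1 x : copies_act 1%g x = x.
Proof. by case: x => i h; rewrite /copies_act mul1g. Qed.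

Fact copies_actM g h x :
  copies_act (g * h)%g x = copies_act g (copies_act h x).
Proof. by rewrite /copies_act /= mulgA. Qed.

Definition copies_gset : gset gT := GSet copies_act1 copies_actM.

Definition copies_proj : gmap copies_gset (regular_gset gT) :=
  @GMap gT copies_gset (regular_gset gT) snd (fun _ _ => erefl).

(** Both sides have the same restriction along the orbit map of (i, h): in the
    sum, the orbit map of (j, 1) has an empty pullback against it for j != i,
    and pullback id and right translation by h for j = i. *)
Lemma res_copies_proj (M : mackey gT) (c : M (regular_gset gT)) :
  mres M copies_proj c =
    \sum_i mtr M (@orbit_map gT copies_gset (i, 1%g)) c.
Proof.
apply/eqP; rewrite -subr_eq0; apply/eqP.
apply: free_res_eq0 => [g [i h] /= [/eqP]|[i h]].
  by rewrite -{2}[h]mul1g (inj_eq (mulIg h)) => /eqP.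
pose r : gmap (regular_gset gT) (regular_gset gT) :=
  @orbit_map gT (regular_gset gT) h.
pose idr : gmap (regular_gset gT) (regular_gset gT) :=
  @GMap gT (regular_gset gT) (regular_gset gT) id (fun _ _ => erefl).
rewrite raddfB -(@mres_comp _ M _ _ _ _ _ r) //= raddf_sum (bigD1 i) //= big1.
  rewrite addr0 (@mpullback _ M _ _ _ _ _ _ idr r).
    by rewrite mtr_id // subrr.
  split=> [g|a b /= [ab]]; first by rewrite /= /copies_act /= mulg1.
  by exists b; split=> [|? [_ ->]]; rewrite // -ab mulg1.
move=> j ji; rewrite (@mpullback _ M _ _ _ _ _ _ (from_empty _) (from_empty _)).
  by rewrite [mres _ _ c]mempty ?raddf0 // card_void.
by split=> [[]|a b /= [ij _]]; case/eqP: ji.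
Qed.

End Copies.

(** The pullback of f and of the orbit map of y is the union of copies of G
    indexed by the fibre of f over y, the point (x, g) going to g x in X
    and to g in G. *)
Lemma res_orbit_tr (M : mackey gT) X Y (f : gmap X Y) (y : Y)
    (c : M (regular_gset gT)) :
  mres M f (mtr M (orbit_map y) c) =
    \sum_(x | f x == y) mtr M (orbit_map x) c.
Proof.
pose I : finType := {x : X | f x == y}.
have aJ g (p : copies_gset I) :
    gact (gact g p).2 (val (gact g p).1) = gact g (gact p.2 (val p.1)).
  exact: gactM.
pose a : gmap (copies_gset I) X :=
  @GMap gT (copies_gset I) X (fun p => gact p.2 (val p.1)) aJ.
rewrite (@mpullback _ M _ _ _ _ _ _ a (copies_proj I)); last first.
  split=> [[[x /= /eqP fx] g] /=|g x /= gy]; first by rewrite gmapJ fx.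
  have fx : f (gact g^-1%g x) == y.
    by rewrite gmapJ -gy -gactM mulVg gact1.
  exists (Sub (gact g^-1%g x) fx, g); split=> [|[[x' fx'] g'] /= [gg' xE]] /=.
    by rewrite -gactM mulgV gact1.
  congr pair => //; apply: val_inj.
  by rewrite /= -xE gg' -gactM mulVg gact1.
rewrite res_copies_proj raddf_sum.
rewrite [RHS](@big_bij _ _ _ _ _ xpredT _ (val : I -> X)) => [|[]//|x fx].
  apply: eq_bigr => x _.
  rewrite -(@mtr_comp _ M _ _ _ _ _ (orbit_map (val x))) // => g /=.
  by rewrite mulg1.
by exists (Sub x fx); split=> // x' [_ xE]; apply: val_inj.
Qed.

End DoubleCoset.

(** * Co-induction as a left adjoint *)

Section PointFunctions.
Variables (gT : finGroupType) (A : comPzRingType).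
Implicit Types X : gset gT.

Definition point_fun X (x0 : X) (a : A) : coind gT A X :=
  [ffun x => if x == x0 then a else 0].

Fact point_fun_zmod X (x0 : X) : zmod_morphism (@point_fun X x0).
Proof.
by move=> a b; apply/ffunP => x; rewrite !ffunE; case: ifP; rewrite ?subr0.
Qed.
HB.instance Definition _ X (x0 : X) :=
  GRing.isZmodMorphism.Build A (coind gT A X) (@point_fun X x0)
    (@point_fun_zmod X x0).
End PointFunctions.

Local Notation delta1 a := (@point_fun _ _ (regular_gset _) 1%g a).

Section LeftAdjoint.
Variables (gT : finGroupType) (A : comPzRingType).
Implicit Types X Y : gset gT.

(** The reason why transfers determine maps out of a co-induced functor: every
    function supported at a point comes from the regular G-set. *)
Lemma point_fun_tr X (x : X) (a : A) :
  point_fun x a = ttr (coind gT A) (orbit_map x) (delta1 a).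
Proof.
apply/ffunP => y; rewrite !ffunE (eq_bigr (fun g => if g == 1%g then a else 0)).
  rewrite -big_mkcondr big_andbC big_mkcondr (big_pred1 1%g) //=.
  by rewrite gact1 eq_sym.
by move=> g _; rewrite ffunE.
Qed.

Lemma coind_sum_points X (u : coind gT A X) :
  u = \sum_x point_fun x (u x).
Proof.
apply/ffunP => y; rewrite sum_ffunE (bigD1 y) //= ffunE eqxx big1 ?addr0 //.
by move=> x xy; rewrite ffunE eq_sym (negPf xy).
Qed.

Section Extension.
Variables (M : mackey gT) (alpha : {additive A -> M (regular_gset gT)}).

(** The left adjoint transpose of alpha. *)
Definition coind_ext_fun X (u : mackey_of (coind gT A) X) : M X :=
  \sum_x mtr M (orbit_map x) (alpha ((u : coind gT A X) x)).

Fact coind_ext_zmod X : zmod_morphism (@coind_ext_fun X).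
Proof.
move=> u v; rewrite /coind_ext_fun -sumrB; apply: eq_bigr => x _.
by rewrite !ffunE !raddfB.
Qed.
HB.instance Definition _ X :=
  GRing.isZmodMorphism.Build (mackey_of (coind gT A) X) (M X)
    (@coind_ext_fun X) (@coind_ext_zmod X).

(** After the double coset formula, both sides are sums over X, on the right
    arranged by the fibres of f. *)
Fact coind_ext_res X Y (f : gmap X Y) u :
  coind_ext_fun (mres (mackey_of (coind gT A)) f u) =
  mres M f (coind_ext_fun u).
Proof.
rewrite /coind_ext_fun raddf_sum.
under [RHS]eq_bigr do rewrite res_orbit_tr.
rewrite (partition_big f xpredT) //=; apply: eq_bigr => y _.
by apply: eq_bigr => x /eqP fx; rewrite ffunE fx.
Qed.

Fact coind_ext_tr X Y (f : gmap X Y) u :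
  coind_ext_fun (mtr (mackey_of (coind gT A)) f u) = mtr M f (coind_ext_fun u).
Proof.
rewrite /coind_ext_fun raddf_sum [RHS](partition_big f xpredT) //=.
apply: eq_bigr => y _; rewrite ffunE !raddf_sum.
apply: eq_bigr => x /eqP fx.
by apply: (mtr_comp (h := orbit_map y)) => g /=; rewrite gmapJ fx.
Qed.

Definition coind_ext : mmap (mackey_of (coind gT A)) M :=
  @MMap gT (mackey_of (coind gT A)) M
    (fun X => @coind_ext_fun X : {additive mackey_of (coind gT A) X -> M X})
    coind_ext_res coind_ext_tr.

(** Transfers commute with F, and the functions supported at the unit of G
    generate Coind A under sums and transfers. *)
Lemma coind_ext_unique (F : mmap (mackey_of (coind gT A)) M) :
  (forall a, F _ (delta1 a) = alpha a) ->
  forall X u, F X u = coind_ext X u.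
Proof.
move=> Falpha X u; rewrite {1}[u]coind_sum_points raddf_sum.
apply: eq_bigr => x _; rewrite point_fun_tr.
by rewrite (mmap_tr F (orbit_map x)) Falpha.
Qed.

End Extension.
End LeftAdjoint.

(** * Co-induction preserves relative tensor products *)

Section BalancedPairing.
Variables (gT : finGroupType) (R A B : comPzRingType).
Variables (f : {rmorphism R -> A}) (g : {rmorphism R -> B}).
Variables (M : mackey gT).
Variable th : balanced_pairing (coind_map gT f) (coind_map gT g) M.

Definition pairing_at1 (a : A) (b : B) : M (regular_gset gT) :=
  th (regular_gset gT) (delta1 a) (delta1 b).

(** The function supported at x with value a is its own product with the
    idempotent of the point x, which comes from R and can be moved across the
    balanced pairing to b. *)
Lemma pairing_pointl (X : gset gT) (x : X) a (b : coind gT B X) :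
  th X (point_fun x a) b = th X (point_fun x a) (point_fun x (b x)).
Proof.
have aE : point_fun x a * coind_map gT f X (point_fun x 1) = point_fun x a.
  by apply/ffunP => y; rewrite !ffunE; case: eqP => _;
    rewrite ?rmorph1 ?mulr1 ?mul0r.
rewrite -{1}aE pairing_balanced; congr (th X _ _).
apply/ffunP => y; rewrite !ffunE.
by case: eqP => [->|_]; rewrite ?rmorph1 ?rmorph0 ?mul1r ?mul0r.
Qed.

(** Frobenius reciprocity: a is a sum of transfers of functions supported at
    the unit of G, and pairing a transfer with b amounts to transferring the
    pairing with the restriction of b. *)
Lemma pairing_sum_points (X : gset gT) (a : coind gT A X) (b : coind gT B X) :
  th X a b = \sum_x mtr M (orbit_map x) (pairing_at1 (a x) (b x)).
Proof.
have thl : zmod_morphism (th X ^~ b).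
  move=> u v; apply/eqP; rewrite -subr_eq opprK addrC -pairingDl.
  by rewrite addrC subrK.
pose thb : {additive coind gT A X -> M X} :=
  HB.pack (th X ^~ b) (GRing.isZmodMorphism.Build _ _ _ thl).
rewrite -[LHS]/(thb a) [in LHS](coind_sum_points a) raddf_sum.
apply: eq_bigr => x _; rewrite /= point_fun_tr pairing_trl pairing_pointl.
by rewrite ffunE /= gact1.
Qed.

End BalancedPairing.

Section Box.
Variables (gT : finGroupType) (R A B C : comPzRingType).
Variables (f : {rmorphism R -> A}) (g : {rmorphism R -> B}).
Variables (j1 : {rmorphism A -> C}) (j2 : {rmorphism B -> C}).

(** When C is the tensor product of A and B over R, through the isomorphism chi,
    pairings correspond to additive maps from C to M(G) and hence to maps
    of Mackey functors out of Coind C. *)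
Lemma coind_box_universal (P : tensor_product f g) (chi : {additive P -> C}) :
    (forall a b, chi (tens P a b) = j1 a * j2 b) -> bijective chi ->
  forall (M : mackey gT)
    (th : balanced_pairing (coind_map gT f) (coind_map gT g) M),
  exists2 F : mmap (mackey_of (coind gT C)) M,
    forall X a b, F X (coind_map gT j1 X a * coind_map gT j2 X b) = th X a b &
    forall F' : mmap (mackey_of (coind gT C)) M,
      (forall X a b,
         F' X (coind_map gT j1 X a * coind_map gT j2 X b) = th X a b) ->
      forall X z, F' X z = F X z.
Proof.
move=> chiE [chi' chiK chi'K] M th.
have [|||al alE alU] := @tensor_universal _ _ _ _ _ P _ (pairing_at1 th).
- by move=> a a' b; rewrite /pairing_at1 raddfD pairingDl.
- by move=> a b b'; rewrite /pairing_at1 raddfD pairingDr.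
- move=> a r b; rewrite /pairing_at1.
  have -> : delta1 (a * f r) = delta1 a *
      coind_map gT f (regular_gset gT) (delta1 r) :> coind gT A _.
    apply/ffunP => y; rewrite !ffunE; by case: eqP => _ //; rewrite mul0r.
  rewrite pairing_balanced; congr (th _ _ _); apply/ffunP => y; rewrite !ffunE.
  by case: eqP => _ //; rewrite mulr0.
pose chi'a : {additive C -> P} :=
  HB.pack chi' (GRing.isZmodMorphism.Build _ _ _
                  (can2_zmod_morphism chiK chi'K)).
pose alpha : {additive C -> M (regular_gset gT)} := al \o chi'a.
(* A map out of Coind C is determined by an additive map on C; transported
   along chi, the latter is determined by its values on pure tensors. *)
exists (coind_ext alpha) => [X a b|F' F'E X z].
  rewrite pairing_sum_points; apply: eq_bigr => x _; congr (mtr M _ _).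
  by rewrite !ffunE /= -chiE chiK.
apply: coind_ext_unique => c /=; rewrite -{1}[c]chi'K.
pose Fr : {additive C -> M (regular_gset gT)} :=
  F' (regular_gset gT) \o @point_fun gT C (regular_gset gT) 1%g.
rewrite -[LHS]/((Fr \o chi) (chi' c)); apply: alU => a b.
rewrite /= chiE /pairing_at1 -F'E; congr (F' _ _).
apply/ffunP => y; rewrite !ffunE.
by case: eqP => _; rewrite ?rmorph0 ?mul0r.
Qed.

Hypothesis box_j : forall r, j1 (f r) = j2 (g r).

Fact coind_box_balanced X r :
  coind_map gT j1 X (coind_map gT f X r) =
  coind_map gT j2 X (coind_map gT g X r).
Proof. by apply/ffunP => x; rewrite !ffunE box_j. Qed.

Definition coind_relbox (P : tensor_product f g) (chi : {additive P -> C})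
    (chiE : forall a b, chi (tens P a b) = j1 a * j2 b)
    (chi_bij : bijective chi) :
    relbox (coind_map gT f) (coind_map gT g) :=
  RelBox coind_box_balanced (coind_box_universal chiE chi_bij).

End Box.

(** * Families of ring elements and of co-induced functors *)

Section RingProduct.
Variables (I : finType) (S T : comPzRingType).

Section Into.
Variable s : I -> {rmorphism S -> T}.

Definition ffun_tuple (t : S) : {ffun I -> T} := [ffun i => s i t].

Fact ffun_tuple_zmod : zmod_morphism ffun_tuple.
Proof. by move=> a b; apply/ffunP => i; rewrite !ffunE rmorphB. Qed.
Fact ffun_tuple_monoid : GRing.monoid_morphism ffun_tuple.
Proof.
by split=> [|a b]; apply/ffunP => i; rewrite !ffunE ?rmorph1 ?rmorphM.
Qed.
HB.instance Definition _ :=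
  GRing.isZmodMorphism.Build S {ffun I -> T} ffun_tuple ffun_tuple_zmod.
HB.instance Definition _ :=
  GRing.isMonoidMorphism.Build S {ffun I -> T} ffun_tuple ffun_tuple_monoid.
End Into.

Definition ffun_eval (i : I) (u : {ffun I -> T}) : T := u i.

Lemma ffun_evalE i u : ffun_eval i u = u i. Proof. by []. Qed.

Fact ffun_eval_zmod i : zmod_morphism (ffun_eval i).
Proof. by move=> u v; rewrite /ffun_eval !ffunE. Qed.
Fact ffun_eval_monoid i : GRing.monoid_morphism (ffun_eval i).
Proof. by split=> [|u v]; rewrite /ffun_eval !ffunE. Qed.
HB.instance Definition _ i :=
  GRing.isZmodMorphism.Build {ffun I -> T} T (ffun_eval i) (ffun_eval_zmod i).
HB.instance Definition _ i :=
  GRing.isMonoidMorphism.Build {ffun I -> T} T (ffun_eval i)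
    (ffun_eval_monoid i).
End RingProduct.

Lemma bijective_tambara_iso (gT : finGroupType) (S T : tambara gT)
    (phi : tmap S T) (psi : forall X, T X -> S X) :
    (forall X, cancel (phi X) (psi X)) -> (forall X, cancel (psi X) (phi X)) ->
  tambara_iso phi.
Proof.
move=> phiK psiK.
pose psir X : {rmorphism T X -> S X} :=
  HB.pack (psi X)
    (GRing.isZmodMorphism.Build _ _ _ (can2_zmod_morphism (phiK X) (psiK X)))
    (GRing.isMonoidMorphism.Build _ _ _
      (can2_monoid_morphism (phiK X) (psiK X))).
have psi_res X Y (f : gmap X Y) b :
    psir X (tres T f b) = tres S f (psir Y b).
  by rewrite /= -{1}[b]psiK -tmap_res phiK.
have psi_tr X Y (f : gmap X Y) b :
    psir Y (ttr T f b) = ttr S f (psir X b).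
  by rewrite /= -{1}[b]psiK -tmap_tr phiK.
have psi_nm X Y (f : gmap X Y) b :
    psir Y (tnm T f b) = tnm S f (psir X b).
  by rewrite /= -{1}[b]psiK -tmap_nm phiK.
by exists (TMap psi_res psi_tr psi_nm).
Qed.

Section Swap.
Variables (gT : finGroupType) (I : finType) (T : comPzRingType).
Implicit Types X Y : gset gT.

(** Functions on X with values in T^I, regarded as families indexed by I of
    functions on X. *)
Definition coind_swap_fun X (u : coind gT {ffun I -> T} X) :
    tprod I (coind gT T) X :=
  [ffun i => coind_map gT (ffun_eval i) X u].

Fact coind_swap_zmod X : zmod_morphism (@coind_swap_fun X).
Proof. by move=> u v; apply/ffunP => i; rewrite !ffunE raddfB. Qed.
Fact coind_swap_monoid X : GRing.monoid_morphism (@coind_swap_fun X).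
Proof.
by split=> [|u v]; apply/ffunP => i; rewrite !ffunE ?rmorph1 ?rmorphM.
Qed.
HB.instance Definition _ X := GRing.isZmodMorphism.Build
  (coind gT {ffun I -> T} X) (tprod I (coind gT T) X) (@coind_swap_fun X)
  (@coind_swap_zmod X).
HB.instance Definition _ X := GRing.isMonoidMorphism.Build
  (coind gT {ffun I -> T} X) (tprod I (coind gT T) X) (@coind_swap_fun X)
  (@coind_swap_monoid X).

Fact coind_swap_res X Y (f : gmap X Y) u :
  coind_swap_fun (tres (coind gT {ffun I -> T}) f u) =
  tres (tprod I (coind gT T)) f (coind_swap_fun u).
Proof. by apply/ffunP => i; rewrite !ffunE tmap_res. Qed.

Fact coind_swap_tr X Y (f : gmap X Y) u :
  coind_swap_fun (ttr (coind gT {ffun I -> T}) f u) =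
  ttr (tprod I (coind gT T)) f (coind_swap_fun u).
Proof. by apply/ffunP => i; rewrite !ffunE tmap_tr. Qed.

Fact coind_swap_nm X Y (f : gmap X Y) u :
  coind_swap_fun (tnm (coind gT {ffun I -> T}) f u) =
  tnm (tprod I (coind gT T)) f (coind_swap_fun u).
Proof. by apply/ffunP => i; rewrite !ffunE tmap_nm. Qed.

Definition coind_swap :
    tmap (coind gT {ffun I -> T}) (tprod I (coind gT T)) :=
  @TMap gT (coind gT {ffun I -> T}) (tprod I (coind gT T))
    (fun X => @coind_swap_fun X :
       {rmorphism coind gT {ffun I -> T} X -> tprod I (coind gT T) X})
    coind_swap_res coind_swap_tr coind_swap_nm.

Lemma coind_swap_iso : tambara_iso coind_swap.
Proof.
pose psi X (u : tprod I (coind gT T) X) : coind gT {ffun I -> T} X :=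
  [ffun x => [ffun i => (u i : coind gT T X) x]].
apply: (bijective_tambara_iso (psi := psi)) => X u.
  by apply/ffunP => x; apply/ffunP => i; rewrite !ffunE.
move: u => /= u; apply/ffunP => i; apply/ffunP => x.
by rewrite !ffunE /= ffun_evalE ffunE.
Qed.
End Swap.

(** * Galois extensions *)

Lemma fixed_iso_inj (H A B : Type) (act : H -> B -> B) (f : A -> B) :
  iso_onto_fixed act f -> injective f.
Proof.
move=> [fixf isof] a b fab; have [|c [_ uc]] := isof (f a).
  by move=> h; exact: fixf.
by rewrite -(uc a) // -(uc b).
Qed.

(** A function fixed under the componentwise action has fixed values, and the
    preimages of the values are chosen one point at a time. *)
Lemma coind_iso_onto_fixed (gT : finGroupType) (H : Type)
    (R T : comPzRingType) (i : {rmorphism R -> T})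
    (sigma : H -> {rmorphism T -> T}) (X : gset gT) :
  iso_onto_fixed sigma i ->
  iso_onto_fixed (fun h => coind_map gT (sigma h) X) (coind_map gT i X).
Proof.
move=> iso; have i_inj := fixed_iso_inj iso; have [fixi isoi] := iso.
split=> [h u|v fixv]; first by apply/ffunP => x; rewrite !ffunE fixi.
have ex x : exists r, i r == (v : coind gT T X) x.
  have [|r [<- _]] := isoi ((v : coind gT T X) x); last by exists r.
  by move=> h; rewrite -{2}[v](fixv h) ffunE.
exists [ffun x => xchoose (ex x)]; split.
  by apply/ffunP => x; rewrite !ffunE; apply/eqP/(xchooseP (ex x)).
move=> u uv; apply/ffunP => x; rewrite ffunE; apply: i_inj.
by rewrite (eqP (xchooseP (ex x))) -uv ffunE.
Qed.

Theorem proposition8p1 (hT : finGroupType) (R T : comPzRingType)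
    (i : {rmorphism R -> T}) (sigma : hT -> {rmorphism T -> T}) :
  ring_galois i sigma ->
  forall gT : finGroupType,
    tambara_galois (coind_map gT i) (fun h : hT => coind_map gT (sigma h)).
Proof.
move=> [[sigma1 sigmaM] sigma_i iso_i [P [chi [chiE chi_bij]]]] gT.
split.
  move=> S a b ab X s; apply/ffunP => x; apply: (fixed_iso_inj iso_i).
  by have /ffunP/(_ x) := ab X s; rewrite !ffunE.
split.
- split=> [X t|g h X t]; apply/ffunP => x; first by rewrite ffunE sigma1.
  by rewrite !ffunE sigmaM.
- by move=> h X r; apply/ffunP => x; rewrite !ffunE sigma_i.
- by move=> K; exact: coind_iso_onto_fixed.
(* Inside T^H, t1 (x) 1 is the constant family t1 and 1 (x) t2 is the family
   of the sigma h t2. *)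
pose idmT : {rmorphism T -> T} := idfun.
pose j1 : {rmorphism T -> {ffun hT -> T}} := ffun_tuple (fun _ : hT => idmT).
pose j2 : {rmorphism T -> {ffun hT -> T}} := ffun_tuple sigma.
have j12 r : j1 (i r) = j2 (i r).
  by apply/ffunP => h; rewrite !ffunE sigma_i.
have chiE' a b : chi (tens P a b) = j1 a * j2 b.
  by rewrite chiE; apply/ffunP => h; rewrite !ffunE.
(* Since sigma k (sigma h t) is sigma (k * h) t, the map id (x) sigma h is
   the translation of the index k to k * h. *)
pose shift h : {rmorphism {ffun hT -> T} -> {ffun hT -> T}} :=
  ffun_tuple (fun k : hT => ffun_eval (k * h)%g).
(* The multiplication of T is evaluation at the unit of H, and the component
   of chi at h is thus evaluation at 1 * h. *)
exists (coind_relbox gT j12 chiE' chi_bij), (coind_map gT (ffun_eval 1%g)),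
  (fun h => coind_map gT (shift h)), (coind_swap gT hT T).
split.
- move=> X a b; apply/ffunP => x.
  by rewrite !ffunE /= !ffun_evalE !ffunE sigma1.
- move=> h X a b; apply/ffunP => x; apply/ffunP => k.
  by rewrite !ffunE /= !ffun_evalE !ffunE sigmaM.
- move=> X z; apply/ffunP => h; apply/ffunP => x.
  by rewrite !ffunE /= !ffun_evalE !ffunE mul1g.
- exact: coind_swap_iso.
Qed.
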